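(* Let $P$ be any pattern and let $n_0$ be a fixed positive integer. If $P$ is $Q_3$-like, then $\operatorname{sat}(m,n_0,P)=\Theta(m)$ as $m\to\infty$.
   Context: All matrices are 0-1 matrices; a pattern is a 0-1 matrix. A matrix $M$ contains $P$ if some submatrix of $M$ (obtained by deleting rows and columns) can be turned into $P$ by changing some number (possibly zero) of its ones to zeroes. The weight is the number of $1$ entries. $M$ is $P$-saturated if $M$ does not contain $P$, but changing any $0$ entry of $M$ to a $1$ yields a matrix containing $P$. $\operatorname{sat}(m,n,P)$ is the minimum weight of an $m\times n$ $P$-saturated matrix. A $k\times\ell$ pattern $P=(p_{ij})$ is called $Q_3$-like if it is of the form $$P=\begin{pmatrix} 0 & 1 & \mathbf 0 & 0 \\ 1 & 0 & \mathbf 0 & 0 \\ 0 & 0 & \mathbf 0 & 1 \\ A & \mathbf 0 & B & C \end{pmatrix}$$ for some submatrices $A,B,C$ of appropriate dimensions ($\mathbf 0$ denotes an all-zero matrix of any size), with at least two $1$ entries in every row other than the first three. In other words: (i) $p_{12}=p_{21}=p_{3\ell}=1$ and these are the only $1$ entries in their rows; (ii) $p_{12}$ is the only $1$ entry in the second column; (iii) all rows of $P$ other than the first three have at least two $1$ entries. *)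

(* Defs.v *)
From mathcomp Require Import all_boot all_order all_algebra.

Set Implicit Arguments.
Unset Strict Implicit.
Unset Printing Implicit Defensive.

(* 0-1 matrices are matrices over [bool], with [true] standing for 1.
   Indices are 0-based. *)

Definition weight m n (M : 'M[bool]_(m, n)) : nat :=
  #|[set ij : 'I_m * 'I_n | M ij.1 ij.2]|.

Definition increasing a b (f : {ffun 'I_a -> 'I_b}) : bool :=
  [forall i : 'I_a, forall j : 'I_a, (i < j) ==> (f i < f j)].

(* [mxsub f g M], with [f] and [g] increasing, is the submatrix of [M] on the
   rows in the image of [f] and the columns in the image of [g]. *)
Definition contains k l (P : 'M[bool]_(k, l)) m n (M : 'M[bool]_(m, n)) : bool :=
  [exists f : {ffun 'I_k -> 'I_m}, exists g : {ffun 'I_l -> 'I_n},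
    [&& increasing f, increasing g
      & [forall i, forall j, P i j ==> mxsub f g M i j]]].

Definition set_one m n (M : 'M[bool]_(m, n)) (i0 : 'I_m) (j0 : 'I_n) :
    'M[bool]_(m, n) :=
  \matrix_(i, j) (((i == i0) && (j == j0)) || M i j).

Definition saturated k l (P : 'M[bool]_(k, l)) m n (M : 'M[bool]_(m, n)) : bool :=
  ~~ contains P M &&
  [forall i, forall j, ~~ M i j ==> contains P (set_one M i j)].

(* The neutral element [m * n] bounds the weight of every m x n matrix, so it
   never affects the minimum if a saturated matrix exists; see [sat_le] and
   [sat_attained].  By [saturated_exists], one does exist whenever [P] has at
   least one 1 entry. *)
Definition sat m n k l (P : 'M[bool]_(k, l)) : nat :=
  \big[minn/(m * n)]_(M : 'M[bool]_(m, n) | saturated P M) weight M.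

(* In 1-based terms, r1, r2, r3 are rows 1, 2, 3 and c1, c2, cl are columns
   1, 2, l. The first three equations say that p_12, p_21, p_3l are the only
   1 entries in their rows, the fourth that p_12 is the only one in its column.
   Together these force k >= 3 and l >= 3. *)
Definition Q3_like k l (P : 'M[bool]_(k, l)) : Prop :=
  exists (r1 r2 r3 : 'I_k) (c1 c2 cl : 'I_l),
    [/\ [/\ r1 = 0 :> nat, r2 = 1 :> nat & r3 = 2 :> nat],
        [/\ c1 = 0 :> nat, c2 = 1 :> nat & cl = l.-1 :> nat],
        [/\ forall j, P r1 j = (j == c2),
            forall j, P r2 j = (j == c1)
          & forall j, P r3 j = (j == cl)],
        forall i, P i c2 = (i == r1)
      & forall i : 'I_k, 3 <= i -> 2 <= #|[set j | P i j]|].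

Lemma weight_le m n (M : 'M[bool]_(m, n)) : weight M <= m * n.
Proof. by rewrite (leq_trans (max_card _)) // card_prod !card_ord. Qed.

Lemma sat_le m n k l (P : 'M[bool]_(k, l)) (M : 'M[bool]_(m, n)) :
  saturated P M -> sat m n P <= weight M.
Proof.
move=> satM; rewrite /sat.
elim: (index_enum _) (mem_index_enum M) => //= N s IHs.
rewrite inE big_cons => /orP[/eqP <-|/IHs les]; first by rewrite satM geq_minl.
by case: ifP => // _; rewrite geq_min les orbT.
Qed.

Lemma sat_attained m n k l (P : 'M[bool]_(k, l)) (M : 'M[bool]_(m, n)) :
  saturated P M ->
  exists2 M' : 'M[bool]_(m, n), saturated P M' & weight M' = sat m n P.
Proof.
move=> satM.
have [M' satM' minM'] := arg_minnP (@weight m n) satM.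
exists M' => //; apply/eqP; rewrite eqn_leq sat_le // andbT {}/sat.
elim/big_ind: _ => [|x y lex ley|N satN]; first exact: weight_le.
- by rewrite leq_min lex ley.
- exact: minM'.
Qed.

Lemma saturated_exists m n k l (P : 'M[bool]_(k, l)) i0 j0 :
  P i0 j0 -> exists M : 'M[bool]_(m, n), saturated P M.
Proof.
move=> Pij; pose Z : 'M[bool]_(m, n) := const_mx false.
have avZ : ~~ contains P Z.
  apply/existsP => -[f /existsP[g /and3P[_ _ /forallP/(_ i0)/forallP/(_ j0)]]].
  by rewrite Pij !mxE.
have [M avM maxM] := @arg_maxnP _ Z (fun N => ~~ contains P N) (@weight m n) avZ.
exists M; rewrite /saturated avM; apply/forallP => i; apply/forallP => j.
apply/implyP => Mij; apply: contraT => /maxM; rewrite /geq /= leqNgt => /negP[].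
apply: proper_card; apply/properP; split.
  by apply/subsetP => -[x y]; rewrite !inE mxE /= => ->; rewrite orbT.
by exists (i, j); rewrite !inE ?mxE /= ?eqxx.
Qed.

(* Main.v *)
Require Import Defs.
From HB Require Import structures.
From mathcomp Require Import all_boot all_order all_algebra.
From mathcomp Require Import all_classical all_reals all_analysis.
Import Order.TTheory GRing.Theory Num.Theory.
Import numFieldNormedType.Exports.
Local Open Scope classical_set_scope.
Local Open Scope ring_scope.

(** The proof shows that an [m x n] matrix with [n > 0] that is saturated
    for a Q_3-like pattern [P] has no empty row ([saturated_row_nonempty]); its
    weight then lies between [m] and [m * n].

    Suppose that row [r] of a saturated matrix [M] is empty. Turning [(r, j)]
    into a 1 creates a copy of [P] in which row [r] has a single 1, so row [r]
    plays one of the first three rows of [P], and [(r, j)] plays the only 1 of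
    that row ([empty_row_role]). Two of these roles are restricted by the ones
    of [M] above row [r].
    - If [(r, j)] plays p_12, then column [j] is empty above [r], since a 1 there
      could replace the new one ([role_p12_col_empty]).
    - If [(r, j)] plays p_3l, then the images of p_12 and p_21 form above [r] an
      inversion: ones [(x, b)] and [(y, a)] with [x < y < r] and [a < b], where
      moreover [b < j] ([role_p3l_inversion]).
    In the last column only the role of p_3l is possible, so there is an
    inversion. Take one with [b] minimal and then [a] maximal. Column [a] is not
    empty above [r], and the minimality of [b] rules out p_3l, so [(r, a)] plays
    p_21. In this copy of [P], let [b'] be the second column; it holds a 1 in
    some row [x'] above [r]. The second column of [P] is empty below its first
    row, so the new one and [(x', b')] could be replaced by [(y, a)] and
    [(x, b)] if [b] were to the left of the third column of the copy; as [M]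
    avoids [P], it is not ([role_p21_third_col]), whence [a < b' < b]. By
    minimality of [b], the ones [(x', b')] and [(y, a)] do not form an inversion,
    so [x < y <= x']. But then [(x, b)] and [(x', b')] form one, which contradicts
    the maximality of [a]. *)

(** * Copies of a pattern *)

Section Copies.
Local Open Scope nat_scope.
Context {k l m n : nat} (P : 'M[bool]_(k, l)).
Implicit Types (M : 'M[bool]_(m, n)) (f : 'I_k -> 'I_m) (g : 'I_l -> 'I_n).

Definition copy M f g : Prop :=
  [/\ forall i i' : 'I_k, i < i' -> f i < f i',
      forall j j' : 'I_l, j < j' -> g j < g j'
    & forall i j, P i j -> M (f i) (g j)].

Lemma containsP M : reflect (exists f g, copy M f g) (contains P M).
Proof.
apply: (iffP existsP) => [[f /existsP[g /and3P[fi gi /forallP Pfg]]]|].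
  exists f, g; split=> [i i' lt|j j' lt|i j Pij].
  - by move/forallP: fi => /(_ i)/forallP/(_ i')/implyP; apply.
  - by move/forallP: gi => /(_ j)/forallP/(_ j')/implyP; apply.
  - by have /forallP/(_ j)/implyP/(_ Pij) := Pfg i; rewrite mxE.
move=> [f [g [fi gi Pfg]]]; exists (finfun f); apply/existsP; exists (finfun g).
apply/and3P; split; apply/forallP => i; apply/forallP => j; apply/implyP.
- by rewrite !ffunE => /fi.
- by rewrite !ffunE => /gi.
- by rewrite mxE !ffunE => /Pfg.
Qed.

Lemma copy_inj_row M f g i i' : copy M f g -> f i = f i' -> i = i'.
Proof.
move=> [fi _ _] eqf; apply: val_inj.
by case: (ltngtP i i') => // /fi; rewrite eqf ltnn.
Qed.

Lemma copy_inj_col M f g j j' : copy M f g -> g j = g j' -> j = j'.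
Proof.
move=> [_ gi _] eqg; apply: val_inj.
by case: (ltngtP j j') => // /gi; rewrite eqg ltnn.
Qed.

End Copies.

Arguments copy_inj_row {k l m n P M f g i i'}.
Arguments copy_inj_col {k l m n P M f g j j'}.

(** * Saturated matrices have no empty row *)

Section EmptyRow.
Local Open Scope nat_scope.
Context {k l m n : nat} {P : 'M[bool]_(k, l)} {M : 'M[bool]_(m, n)}.

Context {r1 r2 r3 : 'I_k} {c1 c2 cl : 'I_l}.
Hypotheses (r1E : r1 = 0 :> nat) (r2E : r2 = 1 :> nat) (r3E : r3 = 2 :> nat).
Hypotheses (c1E : c1 = 0 :> nat) (c2E : c2 = 1 :> nat) (clE : cl = l.-1 :> nat).
Hypotheses (P1 : forall j, P r1 j = (j == c2))
  (P2 : forall j, P r2 j = (j == c1)) (P3 : forall j, P r3 j = (j == cl)).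
Hypothesis Pc2 : forall i, P i c2 = (i == r1).
Hypothesis P4 : forall i : 'I_k, 3 <= i -> 2 <= #|[set j | P i j]%SET|.

Hypothesis avoidM : forall f g, ~ copy P M f g.
Context {r : 'I_m}.
Hypothesis r_empty : forall j, ~~ M r j.
Hypothesis r_sat : forall j, exists f g, copy P (set_one M r j) f g.

Let row_cases (i : 'I_k) : [\/ i = r1, i = r2, i = r3 | 3 <= i].
Proof.
case: (ltnP 2 i) => [?|]; first exact: Or44.
case Ei: (val i) => [|[|[|?]]] // _.
- by apply: Or41; apply: val_inj; rewrite /= r1E.
- by apply: Or42; apply: val_inj; rewrite /= r2E.
- by apply: Or43; apply: val_inj; rewrite /= r3E.
Qed.

Let c2_lt_cl : c2 < cl.
Proof.
have : cl != c2.
  apply/eqP => eqc; have := P3 c2; rewrite Pc2 eqc eqxx => /eqP/(congr1 val)/=.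
  by rewrite r3E r1E.
rewrite ltn_neqAle val_eqE eq_sym => -> /=.
by rewrite clE -ltnS (ltn_predK (ltn_ord c2)) ltn_ord.
Qed.

Lemma set_one_off_row j (i : 'I_m) j' :
  i != r -> set_one M r j i j' = M i j'.
Proof. by move=> /negPf ir; rewrite mxE ir. Qed.

(** A row of the copy that lands on [r] has all its ones mapped to [(r, j)],
    hence at most one 1; rows of [P] from the fourth on have at least two. *)
Lemma empty_row_role j : exists f g, copy P (set_one M r j) f g /\
  [\/ f r1 = r /\ g c2 = j, f r2 = r /\ g c1 = j | f r3 = r /\ g cl = j].
Proof.
have [f [g fgP]] := r_sat j; exists f, g; split=> //.
have [fi gi Pfg] := fgP.
have [i fir] : exists i, f i = r.
  have [/existsP[i /eqP fir]|/existsPn f_off] := boolP [exists i, f i == r].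
    by exists i.
  by exfalso; apply: (@avoidM f g); split=> // i j' /Pfg; rewrite set_one_off_row.
have row_i j' : P i j' -> g j' = j.
  move=> /Pfg; rewrite mxE fir eqxx (negPf (r_empty _)) orbF /= => /eqP.
  by [].
case: (row_cases i) => [iE|iE|iE|/P4/card_gt1P[x [y [+ + ]]]].
- by subst i; apply: Or31; split=> //; apply: row_i; rewrite P1.
- by subst i; apply: Or32; split=> //; apply: row_i; rewrite P2.
- by subst i; apply: Or33; split=> //; apply: row_i; rewrite P3.
- rewrite !inE => /row_i gx /row_i gy /eqP[].
  by apply: (copy_inj_col fgP); rewrite gx gy.
Qed.

(** The image of the first row of [P] can be moved up from [r] to [x]: all its
    other rows are mapped below [r], and p_12 is its only 1. *)
Lemma role_p12_col_empty {j f g} {x : 'I_m} :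
  copy P (set_one M r j) f g -> f r1 = r -> g c2 = j -> x < r -> ~~ M x j.
Proof.
move=> fgP fr gj xr; have [fi gi Pfg] := fgP; apply/negP => Mxj.
pose f' i := if i == r1 then x else f i.
apply: (@avoidM f' g); split=> // [i i' lt|i j' Pij]; rewrite /f'.
  have i'1 : i' != r1 by rewrite -val_eqE /= r1E; case: (val i') lt.
  rewrite (negPf i'1); case: eqP => [i1|_]; last exact: fi.
  by apply: ltn_trans xr _; rewrite -fr -i1; apply: fi.
case: eqP => [i1|/eqP i1].
  by move: Pij; rewrite i1 P1 => /eqP->; rewrite gj.
rewrite -(set_one_off_row j) ?Pfg//.
apply/eqP => fir; move/eqP: i1; apply.
by apply: (copy_inj_row fgP); rewrite fir.
Qed.

Definition inversion (b a : 'I_n) : bool :=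
  [exists x : 'I_m, exists y : 'I_m,
    [&& x < y, y < r, a < b, M x b & M y a]].

Lemma inversionP (b a : 'I_n) : reflect
  (exists x y : 'I_m, [/\ x < y, y < r, a < b, M x b & M y a]) (inversion b a).
Proof.
apply: (iffP existsP) => [[x /existsP[y /and5P[]]]|[x [y [*]]]].
  by exists x, y.
by exists x; apply/existsP; exists y; apply/and5P.
Qed.

Lemma role_p3l_inversion {j f g} :
  copy P (set_one M r j) f g -> f r3 = r -> inversion (g c2) (g c1).
Proof.
move=> [fi gi Pfg] fr; apply/inversionP; exists (f r1), (f r2).
have f12 : f r1 < f r2 by apply: fi; rewrite r1E r2E.
have f2r : f r2 < r by rewrite -fr; apply: fi; rewrite r2E r3E.
have f1r := ltn_trans f12 f2r.
split=> //; first by apply: gi; rewrite c1E c2E.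
- rewrite -(set_one_off_row j) ?Pfg ?P1//.
  by rewrite -val_eqE neq_ltn f1r.
- rewrite -(set_one_off_row j) ?Pfg ?P2//.
  by rewrite -val_eqE neq_ltn f2r.
Qed.

(** Otherwise the ones of the inversion could replace the images of p_12 and
    p_21. Their rows are above [r], hence above the images of the other rows of
    [P], and moving the second column to [b] only affects p_12, the single 1 of
    that column. *)
Lemma role_p21_third_col {a b : 'I_n} {f g} :
  copy P (set_one M r a) f g -> f r2 = r -> g c1 = a -> inversion b a ->
  exists2 j : 'I_l, c2 < j & g j <= b.
Proof.
move=> [fi gi Pfg] fr ga /inversionP[x [y [xy yr ab Mxb Mya]]].
case: (boolP [exists j : 'I_l, (c2 < j) && (g j <= b)]) => [|/existsPn b_left].
  by case/existsP => j /andP[]; exists j.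
have {}b_left (j : 'I_l) : c2 < j -> b < g j.
  by move=> c2j; have := b_left j; rewrite c2j /= -ltnNge.
pose f' i := if i == r1 then x else if i == r2 then y else f i.
pose g' j := if j == c2 then b else g j.
have f_below (i : 'I_k) : 2 <= i -> r < f i.
  by rewrite -fr => ?; apply: fi; rewrite r2E.
case: (@avoidM f' g'); rewrite /f' /g'; split=> [i i'|j j'|i j Pij].
- rewrite -!val_eqE /= r1E r2E.
  case Ei: (val i) => [|[|z]]; case Ei': (val i') => [|[|z']] //= lt.
  + by apply: ltn_trans xy (ltn_trans yr _); apply: f_below; rewrite Ei'.
  + by apply: ltn_trans yr _; apply: f_below; rewrite Ei'.
  + by apply: fi; rewrite Ei Ei'.
- move=> lt; case: (eqVneq j c2) lt => [->|jc2] lt.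
    have -> : (j' == c2) = false by rewrite -val_eqE gtn_eqF.
    exact: b_left.
  case: (eqVneq j' c2) lt => [->|j'c2] lt; last exact: gi.
  have -> : j = c1.
    by apply: val_inj; move: lt; rewrite /= c1E c2E; case: (val j).
  by rewrite ga.
- move: Pij; case: (eqVneq i r1) => [->|i1].
    by rewrite P1 => /eqP->; rewrite eqxx.
  case: (eqVneq i r2) => [->|i2].
    rewrite P2 => /eqP->; rewrite ga.
    by rewrite (_ : c1 == c2 = false) // -val_eqE /= c1E c2E.
  case: (eqVneq j c2) => [->|jc2 Pij]; first by rewrite Pc2 (negPf i1).
  rewrite -(set_one_off_row a) ?Pfg//.
  rewrite -val_eqE neq_ltn f_below ?orbT //.
  by move: i1 i2; rewrite -!val_eqE /= r1E r2E; case: (val i) => [|[|]].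
Qed.

Lemma empty_row_absurd : 0 < n -> False.
Proof.
move=> n_gt0.
have [b0 inv0] : exists b, [exists a, inversion b a].
  have lastn : n.-1 < n by rewrite prednK.
  have [f [g [fgP role]]] := empty_row_role (Ordinal lastn).
  have [_ gi _] := fgP.
  case: role => [[_ gj]|[_ gj]|[fr gj]].
  - by have := gi _ _ c2_lt_cl; rewrite gj /= ltnNge -ltnS prednK// ltn_ord.
  - have : c1 < c2 by rewrite c1E c2E.
    by move/gi; rewrite gj /= ltnNge -ltnS prednK// ltn_ord.
  - by exists (g c2); apply/existsP; exists (g c1); apply: role_p3l_inversion fgP fr.
case: (@arg_minnP _ b0 (fun b => [exists a, inversion b a]) val inv0) => b.
move=> /existsP[a0 inva0] b_min.
case: (@arg_maxnP _ a0 (inversion b) val inva0) => a inv_ba a_max.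
have [x [y [xy yr ab Mxb Mya]]] := inversionP _ _ inv_ba.
have [f [g [fgP role]]] := empty_row_role a.
have [fi gi Pfg] := fgP.
case: role => [[fr gj]|[fr gj]|[fr gj]].
- by have := role_p12_col_empty fgP fr gj yr; rewrite Mya.
- have [c c2c gcb] := role_p21_third_col fgP fr gj inv_ba.
  have b'b : g c2 < b by apply: leq_trans gcb; apply: gi.
  have ab' : a < g c2 by rewrite -gj; apply: gi; rewrite c1E c2E.
  have x'r : f r1 < r by rewrite -fr; apply: fi; rewrite r1E r2E.
  have Mx'b' : M (f r1) (g c2).
    by rewrite -(set_one_off_row a) ?Pfg ?P1// -val_eqE neq_ltn x'r.
  have yx' : y <= f r1.
    rewrite leqNgt; apply/negP => x'y.
    have : [exists a, inversion (g c2) a].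
      by apply/existsP; exists a; apply/inversionP; exists (f r1), y.
    by move=> /b_min; rewrite leqNgt b'b.
  have : inversion b (g c2).
    by apply/inversionP; exists x, (f r1); split=> //; apply: leq_trans xy yx'.
  by move=> /a_max; rewrite /geq /= leqNgt ab'.
- have : [exists a, inversion (g c2) a].
    by apply/existsP; exists (g c1); apply: role_p3l_inversion fgP fr.
  move=> /b_min; rewrite leqNgt (ltn_trans _ ab)// -gj.
  exact: gi.
Qed.

End EmptyRow.

(** * Linear bounds on the saturation function *)

Section Bounds.
Local Open Scope nat_scope.

Lemma saturated_row_nonempty k l (P : 'M[bool]_(k, l)) m n
    (M : 'M[bool]_(m, n)) (r : 'I_m) :
  0 < n -> Q3_like P -> saturated P M -> exists j, M r j.
Proof.
move=> n_gt0 [r1 [r2 [r3 [c1 [c2 [cl]]]]]].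
move=> [[r1E r2E r3E] [c1E c2E clE] [P1 P2 P3] Pc2 P4] /andP[avM satM].
apply/existsP; apply: contraT => /existsPn r_empty.
exfalso; apply: (empty_row_absurd r1E r2E r3E c1E c2E clE
  P1 P2 P3 Pc2 P4 _ r_empty) => //.
  by move=> f g fgP; move/containsP: avM; apply; exists f, g.
move=> j; apply/containsP.
by move/forallP: satM => /(_ r)/forallP/(_ j)/implyP; apply.
Qed.

Lemma weight_ge_rows m n (M : 'M[bool]_(m, n)) :
  (forall i, exists j, M i j) -> m <= weight M.
Proof.
move=> /fin_all_exists[h hP].
rewrite -[leqLHS]card_ord -(card_imset _ (_ : injective (fun i => (i, h i)))).
  apply: subset_leq_card; apply/fintype.subsetP => _ /imsetP[i _ ->].
  by rewrite inE /= hP.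
by move=> i i' [].
Qed.

Lemma sat_ge_rows k l (P : 'M[bool]_(k, l)) m n :
  0 < n -> Q3_like P -> m <= sat m n P.
Proof.
move=> n_gt0 PQ; rewrite /sat; elim/big_ind: _ => [|x y mx my|M satM].
- exact: leq_pmulr.
- by rewrite leq_min mx my.
- by apply: weight_ge_rows => i; apply: saturated_row_nonempty satM.
Qed.

Lemma sat_le_cells k l (P : 'M[bool]_(k, l)) m n : sat m n P <= m * n.
Proof.
rewrite /sat; elim/big_ind: _ => // [x y mx my|M _].
- by rewrite geq_min mx.
- exact: weight_le.
Qed.

End Bounds.

Theorem proposition9p5 (R : realType) (k l : nat) (P : 'M[bool]_(k, l))
    (n0 : nat) (n0_gt0 : (0 < n0)%N) (P_Q3 : Q3_like P) :
  (fun m : nat => (sat m n0 P)%:R : R) =Theta_\oo (fun m : nat => m%:R : R).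
Proof.
rewrite eqThetaE qualifE; apply/asboolP; exists (1, n0%:R) => /=.
  by rewrite ltr01 ltr0n.
apply: nearW => m; rewrite !normr_nat mul1r mulrC -natrM !ler_nat.
by split; [exact: sat_ge_rows | exact: sat_le_cells].
Qed.
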